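(* Let $n\ge 6$ and let $Q\subseteq\mathbb{R}^d$, with linear map $p$, be a weakly symmetric subspace extension of the permutahedron $\Pi_n$ with $d<\frac{n(n-1)}{2}$, with respect to $G=S_n$, and let $s=(s_1,\dots,s_d):X\to Q$ be a section as in the definition of weak symmetry. Then there exists a partition of $\{1,\dots,d\}$ into sets $\mathcal{A}_i$ and $\mathcal{B}_j$ such that each $\mathcal{B}_j$ consists of a single element $b_j$ and each $\mathcal{A}_i$ consists of $n$ elements $a^i_1,a^i_2,\dots,a^i_n$, with $$s_{a^i_t}(\pi.x)=s_{a^i_{\pi^{-1}(t)}}(x)\qquad\text{and}\qquad s_{b_j}(\pi.x)=s_{b_j}(x)$$ for every vertex $x\in X$, every $t\in\{1,\dots,n\}$, all $i,j$, and all $\pi\in A_n$.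
   Context: $\Pi_n$ is the convex hull of all coordinate permutations of $(1,2,\dots,n)$, with vertex set $X=\{(\zeta^{-1}(1),\dots,\zeta^{-1}(n)):\zeta\in S_n\}$. $S_n$ acts on $\mathbb{R}^n$ by $(\pi.x)_v=x_{\pi^{-1}(v)}$ and $S_d$ acts on $\mathbb{R}^d$ by $(\varkappa.y)_j=y_{\varkappa^{-1}(j)}$. A subspace extension of $\Pi_n$ is a set $Q\subseteq\mathbb{R}^d$ that is the intersection of an affine subspace with $\mathbb{R}^d_+$, together with a linear map $p:\mathbb{R}^d\to\mathbb{R}^n$ with $p(Q)=\Pi_n$. A section is a map $s:X\to Q$ with $p(s(x))=x$; the extension is weakly symmetric if there is a section $s$ such that for each $\pi\in S_n$ there is $\varkappa_\pi\in S_d$ with $s(\pi.x)=\varkappa_\pi.s(x)$ for all $x\in X$. $A_n$ denotes the alternating group on $\{1,\dots,n\}$. *)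

(* Defs.v *)
From HB Require Import structures.
From mathcomp Require Import all_boot all_order all_algebra all_fingroup all_solvable alt.
From mathcomp Require Import reals.
Set Implicit Arguments. Unset Strict Implicit. Unset Printing Implicit Defensive.
Import Order.TTheory GRing.Theory Num.Theory.
Local Open Scope ring_scope.

Definition pact (R : realType) (n : nat) (pi : 'S_n) (x : 'rV[R]_n) : 'rV[R]_n :=
  \row_(v < n) x 0 ((pi^-1)%g v).

(* Vertex of Pi_n associated with zeta : (zeta^{-1}(1), ..., zeta^{-1}(n)),
   shifted to 0-based indices: entry j is (zeta^{-1} j) + 1. *)
Definition pvertex (R : realType) (n : nat) (zeta : 'S_n) : 'rV[R]_n :=
  \row_(j < n) (((zeta^-1)%g j : nat).+1)%:R.

Definition inX (R : realType) (n : nat) (x : 'rV[R]_n) : Prop :=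
  exists zeta : 'S_n, x = pvertex R zeta.

Definition permutahedron (R : realType) (n : nat) (x : 'rV[R]_n) : Prop :=
  exists lam : 'S_n -> R,
    (forall z, 0 <= lam z) /\ \sum_z lam z = 1 /\ x = \sum_z lam z *: pvertex R z.

Definition affine_subspace (R : realType) (d : nat) (L : 'rV[R]_d -> Prop) : Prop :=
  (forall y, ~ L y) \/
  exists (y0 : 'rV[R]_d) (V : {vspace 'rV[R]_d}), forall y, L y <-> (y - y0 \in V).

Definition nonneg (R : realType) (d : nat) (y : 'rV[R]_d) : Prop :=
  forall j, 0 <= y 0 j.

Definition subspace_extension (R : realType) (n d : nat)
  (Q : 'rV[R]_d -> Prop) (p : {linear 'rV[R]_d -> 'rV[R]_n}) : Prop :=
  (exists L, affine_subspace L /\ forall y, Q y <-> (L y /\ nonneg y)) /\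
  (forall x, permutahedron x <-> exists y, Q y /\ p y = x).

Definition is_section (R : realType) (n d : nat)
  (Q : 'rV[R]_d -> Prop) (p : {linear 'rV[R]_d -> 'rV[R]_n}) (s : 'rV[R]_n -> 'rV[R]_d) : Prop :=
  forall x, inX x -> Q (s x) /\ p (s x) = x.

Definition weakly_symmetric_section (R : realType) (n d : nat) (s : 'rV[R]_n -> 'rV[R]_d) : Prop :=
  forall pi : 'S_n, exists kappa : 'S_d,
    forall x, inX x -> s (pact pi x) = pact kappa (s x).

(* Main.v *)
Require Import Defs.
From HB Require Import structures.
From mathcomp Require Import all_boot all_order all_algebra all_fingroup all_solvable alt.
From mathcomp Require Import reals.
From mathcomp Require Import zify ring.
Import Order.TTheory GRing.Theory Num.Theory.
Set Implicit Arguments. Unset Strict Implicit. Unset Printing Implicit Defensive.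

(* The hypotheses are contradictory: an extension with fewer than n(n-1)/2
   variables does not exist, so the conclusion holds vacuously.
   Let Z_j be the set of permutations z such that s_j vanishes at the vertex of z.
   Weak symmetry makes the family of the Z_j stable under translations, and
   convexity shows that every vertex off the facet of {1..m} is separated from
   that facet by some Z_j containing the facet. For m = 1 and m = n - 1 the
   stabilizer in S_n of a separating Z_j is intransitive of index less than
   n(n-1)/2, so it contains the alternating group of the complement of a point.
   This uses up at least 2n of the Z_j, which leaves index less than n(n-5)/2
   for any other stabilizer; Bochert's argument then produces a 3-cycle, and the
   blocks of points joined by 3-cycles force the same conclusion. Hence the even
   part of each separating Z_j is {z | z^-1 t \in A} for some t and A; each A comes
   with all n values of t, so there are fewer than (n-1)/2 sets A, whereas
   separating the facets for m = 1..n-1 requires at least (n-1)/2. *)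

(** * 3-cycles in a permutation group and the blocks of points they join *)

Section ThreeCycles.

Local Open Scope group_scope.

Variable T : finType.
Implicit Types (u v w x y : T) (s g : {perm T}) (H : {group {perm T}}).

(** Products act from left to right, so for distinct points this is the cycle u -> v -> w -> u. *)
Definition cycle3 u v w : {perm T} := tperm u v * tperm u w.

Lemma cycle3J u v w g : cycle3 u v w ^ g = cycle3 (g u) (g v) (g w).
Proof. by rewrite /cycle3 conjMg !tpermJ. Qed.

Lemma cycle3V u v w : (cycle3 u v w)^-1 = cycle3 u w v.
Proof. by rewrite /cycle3 invMg !tpermV. Qed.

Lemma cycle3_rot u v w : w != u -> w != v -> cycle3 u v w = cycle3 v w u.
Proof.
move=> wu wv; rewrite /cycle3 (tpermC v u) conjgCV tpermV tpermJ.
by rewrite tpermL (tpermD (z := w)) // eq_sym.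
Qed.

Lemma cycle3E1 u v w : u != v -> w != v -> cycle3 u v w u = v.
Proof. by move=> uv vw; rewrite permM tpermL tpermD. Qed.

Lemma cycle3E2 u v w : cycle3 u v w v = w.
Proof. by rewrite permM tpermR tpermL. Qed.

Lemma cycle3E3 u v w : u != w -> v != w -> cycle3 u v w w = u.
Proof. by move=> uv vw; rewrite permM (tpermD uv vw) tpermR. Qed.

Lemma cycle3D u v w x : x != u -> x != v -> x != w -> cycle3 u v w x = x.
Proof. by move=> xu xv xw; rewrite permM !tpermD // eq_sym. Qed.

(** An H-invariant equivalence relation; on each of its classes H contains every even
    permutation. *)
Definition rel3 H u v :=
  (u == v) || [exists w, [&& w != u, w != v & cycle3 u v w \in H]].

Lemma rel3P H u v : u != v ->
  reflect (exists w, [/\ w != u, w != v & cycle3 u v w \in H]) (rel3 H u v).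
Proof.
move=> uv; rewrite /rel3 (negPf uv) /=.
by apply: (iffP existsP) => -[w] => [/and3P[]|[? ? ?]]; exists w => //; apply/and3P.
Qed.

Lemma rel3_refl H u : rel3 H u u.
Proof. by rewrite /rel3 eqxx. Qed.

Lemma rel3J H u v g : g \in H -> rel3 H (g u) (g v) = rel3 H u v.
Proof.
have aux h a b : h \in H -> rel3 H a b -> rel3 H (h a) (h b).
  move=> hH; have [<- _|ab] := eqVneq a b; first exact: rel3_refl.
  case/(rel3P _ ab) => w [wa wb cH]; apply/rel3P; first by rewrite (inj_eq perm_inj).
  by exists (h w); rewrite !(inj_eq perm_inj) -cycle3J groupJ.
move=> gH; apply/idP/idP; last exact: aux.
by move/(aux g^-1 _ _ (groupVr gH)); rewrite !permK.
Qed.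

Lemma rel3_sym H u v : rel3 H u v = rel3 H v u.
Proof.
have aux a b : rel3 H a b -> rel3 H b a.
  have [<- //|ab] := eqVneq a b; case/(rel3P _ ab) => w [wa wb cH].
  apply/rel3P; first by rewrite eq_sym.
  by exists w; split=> //; rewrite -groupV cycle3V -cycle3_rot // eq_sym.
by apply/idP/idP; apply: aux.
Qed.

(** Let (u v x) in H join u to v. If w is x, this cycle also joins u to w; otherwise it carries u to
    v and fixes w, and invariance under H applies. *)
Lemma rel3_trans H v u w : rel3 H u v -> rel3 H v w -> rel3 H u w.
Proof.
have [<- //|uv] := eqVneq u v; have [<- //|vw] := eqVneq v w.
have [<- _ _|uw] := eqVneq u w; first exact: rel3_refl.
case/(rel3P _ uv) => x [xu xv cx]; case/(rel3P _ vw) => y [yv yw cy].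
have [ewx|wx] := eqVneq w x.
  subst x; apply/rel3P=> //; exists v; split=> //; first by rewrite eq_sym.
  by rewrite -cycle3V groupV.
rewrite -(rel3J u w cx) cycle3E1 //.
rewrite cycle3D //; try by rewrite eq_sym.
by apply/rel3P=> //; exists y.
Qed.

(** Take cycles (u v x) and (u w y) in H. For x = y, conjugating one by the other gives (u v w) up
    to orientation; for distinct fresh x and y it gives (w v x), which [key] combines with (u v
    x). *)
Lemma cycle3_class H u v w : u != v -> u != w -> v != w ->
  rel3 H u v -> rel3 H u w -> cycle3 u v w \in H.
Proof.
move=> uv uw vw /(rel3P _ uv)[x [xu xv cx]] /(rel3P _ uw)[y [yu yw cy]].
have [<- //|xw] := eqVneq x w.
have [<-|yv] := eqVneq y v; first by rewrite -groupV cycle3V.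
have key z : z != u -> z != v -> z != w ->
    cycle3 u v z \in H -> cycle3 w v z \in H -> cycle3 u v w \in H.
  move=> zu zv zw c1 c2; have := groupJ c1 (groupVr c2).
  rewrite cycle3V cycle3J (cycle3D (x := u)) //; try by rewrite eq_sym.
  rewrite cycle3E2 cycle3E3 //; try by rewrite eq_sym.
  by rewrite -groupV cycle3V.
have [exy|xy] := eqVneq x y.
  subst y; have := groupJ cx cy.
  rewrite cycle3J cycle3E1 //.
  rewrite cycle3D //; try by rewrite eq_sym.
  rewrite cycle3E3 //; try by rewrite eq_sym.
  move=> c3; rewrite -groupV cycle3V -cycle3_rot; try by rewrite // eq_sym.
  by rewrite -cycle3_rot // eq_sym.
apply: (key x) => //.
have := groupJ cx cy; rewrite cycle3J cycle3E1 //.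
by rewrite !cycle3D // eq_sym.
Qed.

Lemma tperm2_class H (B : {set T}) u v a b :
    {in B &, forall x y, rel3 H x y} ->
    u \in B -> v \in B -> a \in B -> b \in B -> u != v -> a != b ->
  tperm u v * tperm a b \in H.
Proof.
move=> BH uB vB aB bB uv ab.
have share x y z : x \in B -> y \in B -> z \in B -> x != y -> x != z ->
    tperm x y * tperm x z \in H.
  move=> xB yB zB xy xz; have [->|yz] := eqVneq y z; first by rewrite tperm2 group1.
  by apply: cycle3_class => //; apply: BH.
have [eua|ua] := eqVneq u a; first by subst a; apply: share.
(* Inserting (u a) twice leaves two products of transpositions sharing a point. *)
rewrite -[tperm u v]mulg1 -(tperm2 u a) mulgA -[_ * _ * _ * _]mulgA.
rewrite groupM ?share // tpermC share // eq_sym //.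
Qed.

(** Induction on the number of moved points: multiplying by (x, s x) fixes x and flips the parity,
    and the factor [tperm a b] lets odd permutations take part in the induction. *)
Lemma perm_on_class H (B : {set T}) a b s :
    {in B &, forall x y, rel3 H x y} -> a \in B -> b \in B -> a != b ->
  perm_on B s -> (if odd_perm s then s * tperm a b else s) \in H.
Proof.
move=> BH aB bB ab; have [n] := ubnP #|[pred x | s x != x]|.
elim: n s => // n IHn s; rewrite ltnS => ltn sB.
have [/pred0P fixs|/pred0Pn[x /= sx]] := boolP (pred0b [pred x | s x != x]).
  suff -> : s = 1 by rewrite odd_perm1 group1.
  by apply/permP => x; rewrite perm1; apply/eqP; rewrite -[_ == _]negbK; apply/negbT/fixs.
have xB : x \in B by apply: (subsetP sB).
have sxB : s x \in B by rewrite perm_closed.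
pose t := tperm x (s x).
have tB : perm_on B t.
  by apply: (subset_trans (tperm_on _ _)); apply/subsetP => z /set2P[]->.
have /IHn : perm_on B (s * t) by apply: perm_onM.
rewrite odd_permM odd_tperm (eq_sym x) sx addbT => IH.
have -> : s = (s * t) * t by rewrite -mulgA tperm2 mulg1.
rewrite odd_permM odd_permM odd_tperm (eq_sym x) sx !addbT negbK.
have {}IH : (if ~~ odd_perm s then s * t * tperm a b else s * t) \in H.
  apply: IH; apply: leq_trans ltn; apply: proper_card; apply/properP; split.
    apply/subsetP => z; rewrite !inE; apply: contraNneq => sz; rewrite permM sz.
    by rewrite tpermD //; [apply: contraNneq sx => ->; rewrite sz|
        apply: contraNneq sx => exz; rewrite -(inj_eq (@perm_inj _ s)) exz sz].
  by exists x => /=; [rewrite inE | rewrite inE permM tpermR eqxx].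
case: (odd_perm s) IH => /= IH.
  rewrite -[_ * t * _]mulgA groupM // (tperm2_class BH) //.
  by rewrite eq_sym.
rewrite -(mulg1 (s * t)) -(tperm2 a b) mulgA -[_ * tperm a b * t]mulgA groupM //.
by rewrite (tperm2_class BH) // eq_sym.
Qed.

(** Every lower bound on an index below comes from such a family of representatives of distinct
    right cosets. *)
Lemma index_lower_bound (I : finType) (A : {set I}) (f : I -> {perm T}) H :
    {in A &, forall i j, f i * (f j)^-1 \in H -> i = j} ->
  #|A| <= #|[set: {perm T}] : H|.
Proof.
move=> fH; rewrite -(card_in_imset (f := fun i => H :* f i) (D := mem A)).
  apply: subset_leq_card; apply/subsetP => _ /imsetP[i iA ->].
  by rewrite mem_rcosets; apply/mulsgP; exists 1 (f i); rewrite ?group1 ?mul1g // in_setT.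
move=> i j iA jA /rcoset_eqP; rewrite mem_rcoset; exact: fH.
Qed.

Lemma imset_perm_card (A B : {set T}) : #|A| = #|B| -> exists g : {perm T}, g @: A = B.
Proof.
have [n] := ubnP #|A :\: B|; elim: n A => // n IHn A; rewrite ltnS => ltn cAB.
have [AB0|/set0Pn[u]] := eqVneq (A :\: B) set0.
  exists 1; rewrite imset_perm1; apply/eqP; rewrite eqEcard -cAB leqnn andbT.
  by rewrite -setD_eq0 AB0.
rewrite inE => /andP[uB uA].
have /subsetPn[w wB wA] : ~~ (B \subset A).
  apply: contra uB => BA; have /eqP -> // : B == A by rewrite eqEcard BA cAB /=.
have uw : u != w by apply: contraNneq wA => <-.
have [|//|g gB] := IHn (tperm u w @: A).
- apply: leq_trans ltn; apply: proper_card; apply/properP; split.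
    apply/subsetP => x; rewrite !inE => /andP[xB /imsetP[y yA exy]]; rewrite xB /=.
    move: xB; rewrite exy; by case: tpermP => [_|_ _|_ _ _] //; rewrite wB.
  exists u; rewrite !inE ?uB //=; apply/imsetP => -[y yA].
  case: tpermP => [_ euw|eyw _|yu _ euy].
  - by rewrite euw eqxx in uw.
  - by rewrite -eyw yA in wA.
  - by rewrite euy in yu.
- by rewrite card_imset //; apply: perm_inj.
by exists (tperm u w * g); rewrite -gB -imset_comp; apply: eq_imset => x; rewrite permM.
Qed.

End ThreeCycles.

(** * Binomial and factorial estimates *)

Lemma mul2_bin2 n : 2 * 'C(n, 2) = n * n.-1.
Proof. by rewrite -mul_bin_diag bin1. Qed.

Lemma leq_bin2 n k : 1 < k -> k.+2 <= n -> 'C(n, 2) <= 'C(n, k).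
Proof.
elim: n k => // n IHn [|k] // k1 kn.
have [->//|k2] := eqVneq k 1.
have [->|nk] := eqVneq n k.+2.
  by rewrite -(bin_sub (m := 2)) // subSS subSS subn0.
have b1 : 'C(n, 2) <= 'C(n, k.+1) by apply: IHn; lia.
have b2 : 'C(n, 2) <= 'C(n, k) by apply: IHn; lia.
have := mul2_bin2 n; rewrite (binS n 1) (binS n k) bin1; nia.
Qed.

(** Puts an index below n(n-5)/2 within reach of Bochert's bound, the factorial of n/2 rounded
    up. *)
Lemma mul_lt_fact n : 6 <= n -> n * (n - 5) <= 2 * (uphalf n)`!.
Proof.
move=> n6; have : n <= (uphalf n).*2 by rewrite -leq_uphalf_double.
have : 3 <= uphalf n by rewrite geq_uphalf_double; lia.
move: (uphalf n) => q q3 nq.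
suff qf : q * (q.*2 - 5) <= q`! by nia.
case: q q3 {nq} => [//|q]; rewrite ltnS => q2; rewrite factS leq_mul2l /=.
elim: q q2 => // q IHq; rewrite leq_eqVlt => /predU1P[<- //|q2].
by have := IHq q2; rewrite factS; nia.
Qed.

(** * Permutation groups of small index *)

Section SmallIndex.

Local Open Scope group_scope.

Variable T : finType.
Implicit Types (u v w x y : T) (s g : {perm T}) (H : {group {perm T}}).

(** The product is the commutator of g and s, whose supports meet only in c. *)
Lemma commutator_cycle3 (G : {set T}) c g s :
    c \in G -> perm_on G g -> g c != c -> perm_on (c |: ~: G) s -> s c != c ->
  g^-1 * g ^ s = cycle3 c (s c) (g c).
Proof.
move=> cG gG gc sG sc.
have scG : s c \notin G.
  by have := perm_closed c sG; rewrite !inE eqxx /= (negPf sc) /= => ->.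
have gxG x : (g x \in G) = (x \in G) by rewrite perm_closed.
have gK x : x \notin G -> g x = x by apply: out_perm.
have sK x : x \in G -> x != c -> s x = x.
  by move=> xG xc; apply: (out_perm sG); rewrite !inE negb_or xc xG.
have sxG x : x \notin G -> s x != c -> s x \notin G.
  move=> xG sxc; have := perm_closed x sG.
  by rewrite !inE (negPf xG) (negPf sxc) orbT.
have neqG x y : x \notin G -> y \in G -> x != y.
  by move=> xG; apply: contraTneq => <-.
apply/permP => x; rewrite permM.
have -> : x = g (g^-1 x) by rewrite permKV.
move: (g^-1 x) => {}x; rewrite permK.
have -> : x = s (s^-1 x) by rewrite permKV.
move: (s^-1 x) => {}x; rewrite permJ.
have [->|xc] := eqVneq x c.
  by rewrite (gK (s c)) // cycle3E2 sK // gxG.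
have [xG|xG] := boolP (x \in G).
  rewrite (sK x) //; have [->|gxc] := eqVneq (g x) c.
    by rewrite cycle3E1 // eq_sym // neqG // gxG.
  have gxG' : g x \in G by rewrite gxG.
  by rewrite (sK (g x)) // cycle3D // ?(inj_eq perm_inj) // eq_sym neqG.
rewrite (gK x) //; have [->|sxc] := eqVneq (s x) c.
  by rewrite cycle3E3 // eq_sym // eq_sym neqG // gxG.
have sxG' : s x \notin G by apply: sxG.
rewrite (gK (s x)) // cycle3D // ?(inj_eq perm_inj) //.
by rewrite neqG // gxG.
Qed.

(* Bochert's argument: let G be a minimal base of H. If the complement of G is
   not a base too, H contains two elements whose supports meet in one point. *)
Lemma cycle3_of_index H : #|[set: {perm T}] : H| < (uphalf #|T|)`! ->
  exists u v w, [/\ v != u, w != u, w != v & cycle3 u v w \in H].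
Proof.
(* G is a base when only the identity of H fixes G pointwise. *)
move=> ltH; pose base (G : {set T}) := [forall s in H, perm_on (~: G) s ==> (s == 1)].
have baseP (G : {set T}) s : base G -> s \in H -> perm_on (~: G) s -> s = 1.
  by move=> /forallP/(_ s)/implyP bG /bG/implyP sG /sG/eqP.
have baseT : base setT.
  apply/forallP => s; apply/implyP => _; apply/implyP => sT.
  by apply/eqP/(perm_on_id sT); rewrite setCT cards0.
have [G bG minG] := arg_minnP (fun G : {set T} => #|G|) baseT.
have [bCG|] := boolP (base (~: G)).
  have leG : uphalf #|T| <= #|~: G|.
    by rewrite leq_uphalf_double -(cardsC G) -addnn leq_add2r minG.
  have := leq_trans ltH (leq_fact leG); rewrite ltnNge => /negP[].
  (* As G is a base, the permutations supported on its complement lie in distinct cosets of H. *)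
  rewrite -card_perm -cardsE; apply: (index_lower_bound (f := id)) => s s'.
  rewrite !inE => sG s'G /(baseP _ _ bG) e; apply/eqP; rewrite eq_mulgV1.
  by apply/eqP/e; rewrite perm_onM ?perm_onV.
rewrite negb_forall => /existsP[g]; rewrite !negb_imply setCK => /and3P[gH gG g1].
have [c gc] : exists c, g c != c.
  apply/existsP; apply: contraNT g1; rewrite negb_exists => /forallP fg.
  by apply/eqP/permP => x; rewrite perm1; apply/eqP; rewrite -[_ == _]negbK fg.
have cG : c \in G by apply: (subsetP gG); rewrite inE.
(* By minimality some s in H fixes every point of G except c, and it moves c because G is a base. *)
have : ~~ base (G :\ c).
  by apply/negP => /minG; rewrite (cardsD1 c G) cG /= ltnn.
rewrite negb_forall => /existsP[s]; rewrite !negb_imply => /and3P[sH sG s1].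
have sG' : perm_on (c |: ~: G) s.
  by apply: subset_trans sG _; rewrite setCD setUC.
have sc : s c != c.
  apply: contra s1 => /eqP sc; apply/eqP/(baseP G) => //.
  apply/subsetP => x xs; have := subsetP sG' x xs; rewrite !inE in xs *.
  by have [exc|//] := eqVneq x c; rewrite exc sc eqxx in xs.
have scG : s c \notin G.
  by have := perm_closed c sG'; rewrite !inE eqxx /= (negPf sc) /= => ->.
exists c, (s c), (g c); split=> //.
  by apply: contraNneq scG => <-; rewrite perm_closed.
by rewrite -(commutator_cycle3 cG gG gc sG' sc) groupM ?groupV ?groupJ.
Qed.

(** Count the images of the class B of x that contain x. If two permutations producing such images
    share a coset, their quotient in H sends a point of B into B, hence preserves B, and the images
    agree. *)
Lemma class_index H x : 
  'C(#|T|.-1, #|[set y | rel3 H x y]|.-1) <= #|[set: {perm T}] : H|.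
Proof.
set B := [set y | _]; have xB : x \in B by rewrite inE rel3_refl.
pose f (W : {set T}) : {perm T} := odflt 1 [pick g : {perm T} | g @: B == x |: W].
have := cards_draws [set~ x] #|B|.-1; set A := [set W : {set T} | _].
have -> : #|[set~ x]| = #|T|.-1 by rewrite cardsC1.
move=> <-.
have fA W : W \in A -> f W @: B = x |: W.
  rewrite inE => /andP[Wx /eqP cW]; rewrite /f; case: pickP => [g /eqP //|nog].
  have [|g /eqP] := @imset_perm_card T B (x |: W); last by rewrite nog.
  have xW : x \notin W by apply/negP => /(subsetP Wx); rewrite !inE eqxx.
  by rewrite cardsU1 xW cW (cardsD1 x B) xB.
apply: (index_lower_bound (f := f)) => W W' WA W'A; set h := _ * _ => hH.
have [b bB fb] : exists2 b, b \in B & f W b = x.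
  have : x \in f W @: B by rewrite fA // setU11.
  by case/imsetP => b bB ->; exists b.
have [b' b'B fb'] : exists2 b, b \in B & f W' b = x.
  have : x \in f W' @: B by rewrite fA // setU11.
  by case/imsetP => b' b'B ->; exists b'.
have hb : h b = b' by rewrite permM fb -fb' permK.
have sub : x |: W \subset x |: W'.
  rewrite -!fA //; apply/subsetP => _ /imsetP[y yB ->].
  apply/imsetP; exists (h y); last by rewrite /h permM permKV.
  rewrite !inE in bB b'B yB *; apply: rel3_trans b'B _.
  by rewrite -hb rel3J //; apply: rel3_trans yB; rewrite rel3_sym.
have eWW : x |: W = x |: W'.
  by apply/eqP; rewrite eqEcard sub -!fA // !card_imset ?leqnn //; apply: perm_inj.
have xK (V : {set T}) : V \in A -> (x |: V) :\ x = V.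
  rewrite inE => /andP[Vx _]; apply: setU1K.
  by apply/negP => /(subsetP Vx); rewrite !inE eqxx.
by rewrite -(xK W) // eWW xK.
Qed.

(** A 3-cycle gives a class of at least 3 points. Were two points missing from it, [class_index]
    would force index at least (n-1)(n-2)/2, which exceeds n(n-5)/2. *)
Lemma rel3_of_index H : 6 <= #|T| -> 2 * #|[set: {perm T}] : H| < #|T| * (#|T| - 5) ->
  exists t, forall u v, u != t -> v != t -> rel3 H u v.
Proof.
move=> T6 ltH; have [|u [v [w [vu wu wv cH]]]] := @cycle3_of_index H.
  by have := mul_lt_fact T6; lia.
have := class_index H u; set B := [set y | _] => leB.
have cB : 3 <= #|B|.
  have : [set u; v; w] \subset B.
    apply/subsetP => _ /setUP[/set2P[]|/set1P] ->; rewrite inE ?rel3_refl //.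
      by apply/rel3P; [rewrite eq_sym | exists w].
    apply/rel3P; first by rewrite eq_sym.
    by exists v; split=> //; [rewrite eq_sym | rewrite -cycle3V groupV].
  move/subset_leq_card; rewrite -setUA !cardsU1 cards1 !inE !negb_or.
  by rewrite !(eq_sym u) (eq_sym v w) vu wu wv.
have cCB : #|~: B| <= 1.
  have := cardsC B; rewrite leqNgt => eT; apply/negP => B2.
  have : 'C(#|T|.-1, 2) <= 'C(#|T|.-1, #|B|.-1) by apply: leq_bin2; lia.
  have := mul2_bin2 #|T|.-1; move: T6 ltH leB; clear.
  move: #|[set: _] : H| 'C(_, 2) 'C(_, _) => i a b; nia.
have [t tP] : exists t, ~: B \subset [set t].
  have [->|[t tB]] := set_0Vmem (~: B); first by exists u; apply: sub0set.
  exists t; apply/subsetP => x xB; rewrite inE.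
  by apply/eqP; have /card_le1_eqP := cCB; apply.
exists t => a b ta tb; have inB x : x != t -> rel3 H u x.
  move=> xt; have : x \notin ~: B by apply: contra xt => /(subsetP tP); rewrite inE.
  by rewrite !inE negbK.
by apply: (@rel3_trans _ _ u); rewrite ?inB // rel3_sym inB.
Qed.

(** H preserves the orbit A of u, so its index is at least the number of sets of size #|A|. The
    bound leaves only a one-point orbit or a one-point complement. *)
Lemma fix_of_intransitive H u v : 2 * #|[set: {perm T}] : H| < #|T| * #|T|.-1 ->
    (forall h, h \in H -> h u != v) ->
  exists t, forall h, h \in H -> h t = t.
Proof.
move=> ltH huv; pose A := [set h u | h : {perm T} in H].
have uA : u \in A by apply/imsetP; exists 1; rewrite ?group1 ?perm1.
have vA : v \notin A by apply/imsetP => -[h hH vE]; have := huv h hH; rewrite -vE eqxx.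
have hA h x : h \in H -> (h x \in A) = (x \in A).
  have aux g y : g \in H -> y \in A -> g y \in A.
    by move=> gH /imsetP[k kH ->]; apply/imsetP; exists (k * g); rewrite ?groupM ?permM.
  move=> hH; apply/idP/idP; last exact: aux.
  by move/(aux h^-1 _ (groupVr hH)); rewrite permK.
have leA : 'C(#|T|, #|A|) <= #|[set: {perm T}] : H|.
  rewrite -card_draws.
  pose f (W : {set T}) : {perm T} := odflt 1 [pick g : {perm T} | g @: A == W].
  have fA (W : {set T}) : #|W| = #|A| -> f W @: A = W.
    move=> cW; rewrite /f; case: pickP => [g /eqP //|nog].
    by have [|g /eqP] := @imset_perm_card T A W; rewrite ?nog.
  apply: (index_lower_bound (A := [set W : {set T} | #|W| == #|A|]) (f := f)).
  move=> W W'; rewrite !inE => /eqP cW /eqP cW' hH.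
  apply/eqP; rewrite eqEcard cW cW' leqnn andbT -(fA W) // -(fA W') //.
  apply/subsetP => _ /imsetP[y yA ->]; apply/imsetP; exists ((f W * (f W')^-1) y).
    by rewrite hA.
  by rewrite permM permKV.
have cA := cardsC A.
have A0 : 0 < #|A| by apply/card_gt0P; exists u.
have CA0 : 0 < #|~: A| by apply/card_gt0P; exists v; rewrite inE.
have [/eqP A1|A1] := boolP (#|A| == 1%N).
  exists u => h hH; have /card_le1_eqP : #|A| <= 1 by rewrite A1.
  by apply; rewrite ?hA.
have [/eqP CA1|CA1] := boolP (#|~: A| == 1%N).
  exists v => h hH; have /card_le1_eqP : #|~: A| <= 1 by rewrite CA1.
  by apply; rewrite inE ?hA.
have : 'C(#|T|, 2) <= 'C(#|T|, #|A|) by apply: leq_bin2; lia.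
have := mul2_bin2 #|T|; lia.
Qed.

(** For v unrelated to v0 and any a, the permutations (v0 v)(t a) lie in distinct cosets, so fewer
    than (n-1)/2 points are unrelated to v0. Two unrelated points u, v would have [C u] and [C v]
    cover all n-1 points other than t. *)
Lemma rel3_of_fix H t : 2 * #|[set: {perm T}] : H| < #|T| * #|T|.-1 ->
    (forall h, h \in H -> h t = t) ->
  forall u v, u != t -> v != t -> rel3 H u v.
Proof.
move=> ltH fixt.
pose C v0 := [set v | (v != t) && ~~ rel3 H v0 v].
have cC v0 : v0 != t -> 2 * #|C v0| < #|T|.-1.
  move=> v0t; suff leC : #|T| * #|C v0| <= #|[set: {perm T}] : H| by nia.
  rewrite -cardsT -cardsX.
  apply: (index_lower_bound (f := fun i => tperm v0 i.2 * tperm t i.1)).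
  move=> [a v] [b w]; rewrite !inE /= => /andP[vt v0v] /andP[wt v0w].
  rewrite invMg !tpermV => hH.
  have tt z : z != t -> tperm v0 z t = t by move=> zt; rewrite tpermD.
  have eab : a = b.
    have := fixt _ hH; rewrite !permM tt // tpermL => e.
    have e' : tperm t b a = t by apply: (@perm_inj _ (tperm v0 w)); rewrite e tt.
    by apply: (@perm_inj _ (tperm t b)); rewrite e' tpermR.
  subst b; congr (_, _); move: hH; rewrite mulgA -(mulgA (tperm v0 v) (tperm t a)) tperm2 mulg1.
  have nrel z : ~~ rel3 H v0 z -> v0 != z.
    by apply: contraNneq => <-; apply: rel3_refl.
  move=> hH; apply: contraNeq (v0v) => vw.
  apply/rel3P; first exact: nrel.
  by exists w; split=> //; rewrite eq_sym // nrel.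
move=> u v ut vt; apply/negPn/negP => uv.
have : [set~ t] \subset C u :|: C v.
  apply/subsetP => x; rewrite !inE => -> /=; rewrite -negb_and.
  by apply: contra uv => /andP[ux vx]; apply: rel3_trans ux _; rewrite rel3_sym.
move/subset_leq_card; rewrite cardsC1 leqNgt => /negP[].
rewrite (leq_ltn_trans (leq_card_setU _ _)) //.
have := cC u ut; have := cC v vt; lia.
Qed.

End SmallIndex.

(** * Translation-stable families of sets of permutations separating the facets *)

Section SeparatingFamilies.

Local Open Scope group_scope.

Variable n : nat.
Hypothesis n6 : 6 <= n.
Implicit Types (i j k t u v : 'I_n) (z h : 'S_n) (Z : {set 'S_n}) (m : nat).

(** This Young subgroup indexes the vertices of the facet of {1..m}. *)
Definition young m : {set 'S_n} := [set z : 'S_n | [forall i, (z i < m) == (i < m)]].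

Lemma youngP m z : reflect (forall i, (z i < m) = (i < m)) (z \in young m).
Proof.
rewrite inE; apply: (iffP forallP) => zm i; first exact: (eqP (zm i)).
by rewrite zm.
Qed.

Definition stab Z : {group 'S_n} := 'C[Z | 'Rs]%G.

Lemma stabP Z h : reflect (Z :* h = Z) (h \in stab Z).
Proof. by apply: (iffP astab1P); rewrite /= rcosetE. Qed.

Lemma mem_stab Z h z : h \in stab Z -> (z * h \in Z) = (z \in Z).
Proof. by move=> /stabP{1}<-; rewrite mem_rcoset mulgK. Qed.

(** By [perm_on_class], the stabilizer then contains all even permutations fixing t. *)
Definition natural_at Z t := [forall u, forall v, (u != t) ==> (v != t) ==> rel3 (stab Z) u v].

Definition natural Z := [exists t, natural_at Z t].

Lemma natural_atP Z t :
  reflect (forall u v, u != t -> v != t -> rel3 (stab Z) u v) (natural_at Z t).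
Proof.
apply: (iffP forallP) => [nZ u v ut vt | nZ u].
  by have /forallP/(_ v) := nZ u; rewrite ut vt.
by apply/forallP => v; apply/implyP => ut; apply/implyP => vt; apply: nZ.
Qed.

Lemma natural_atJ Z t h : natural_at Z t -> natural_at (Z :* h) (h t).
Proof.
move/natural_atP => nZ; apply/natural_atP => u v; rewrite -(permKV h u) -(permKV h v).
rewrite !(inj_eq perm_inj) => ut vt; have := nZ _ _ ut vt.
have [-> _|uv] := eqVneq (h^-1 u) (h^-1 v); first exact: rel3_refl.
case/(rel3P _ uv) => w [wu wv cZ]; apply/rel3P; first by rewrite (inj_eq perm_inj).
exists (h w); rewrite !(inj_eq perm_inj) -cycle3J wu wv; split=> //.
move/stabP: cZ => cZ; apply/stabP.
by rewrite conjgE -rcosetM mulKVg rcosetM cZ.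
Qed.

Lemma naturalJ Z h : natural (Z :* h) = natural Z.
Proof.
have aux Z' h' : natural Z' -> natural (Z' :* h').
  by case/existsP => t nZ; apply/existsP; exists (h' t); apply: natural_atJ.
by apply/idP/idP; [move/(aux _ h^-1); rewrite rcosetK | apply: aux].
Qed.

Lemma two_others (A : {set 'I_n}) : #|A| <= 2 ->
  exists a b, [/\ a != b, a \notin A & b \notin A].
Proof.
move=> A2; have : 1 < #|~: A| by have := cardsC A; rewrite card_ord; lia.
by case/card_gt1P => a [b [aA bA ab]]; exists a, b; rewrite !inE in aA bA.
Qed.

(** Supplies a transposition that corrects parity while preserving the cut at m. *)
Lemma two_others_side m u v : exists a b : 'I_n,
  [/\ a != b, (a < m) = (b < m) & [/\ a != u, a != v, b != u & b != v]].
Proof.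
pose X := ~: [set u; v]; pose L := [set i : 'I_n | i < m].
have cX : 4 <= #|X|.
  by have := cardsC [set u; v]; rewrite card_ord cards2; case: (u != v) => /=; rewrite -/X; lia.
have [] : 1 < #|X :&: L| \/ 1 < #|X :\: L| by have := cardsID L X; lia.
  case/card_gt1P => a [b []]; rewrite !inE !negb_or => /andP[/andP[au av] am].
  by move=> /andP[/andP[bu bv] bm] ab; exists a, b; rewrite am bm.
case/card_gt1P => a [b []]; rewrite !inE !negb_or => /andP[am /andP[au av]].
by move=> /andP[bm /andP[bu bv]] ab; exists a, b; rewrite (negPf am) (negPf bm).
Qed.

Lemma even_two_transitive u v t t' : u != v -> t != t' ->
  exists z, [/\ ~~ odd_perm z, z u = t & z v = t'].
Proof.
move=> uv tt'; pose z := tperm u t * tperm (tperm u t v) t'.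
have zu : z u = t.
  rewrite permM tpermL tpermD // 1?eq_sym // -{1}(tpermL u t) (inj_eq perm_inj) //.
have zv : z v = t' by rewrite permM tpermL.
clearbody z; have [zo|ze] := boolP (odd_perm z); last by exists z.
have [|a [b [ab]]] := @two_others [set t; t']; first by rewrite cards2; case: (_ != _).
rewrite !inE !negb_or => /andP[a_t at'] /andP[b_t bt'].
exists (z * tperm a b); rewrite odd_permM odd_tperm ab zo !permM.
by rewrite zu zv !tpermD.
Qed.

Lemma even_young m u t : (u < m) = (t < m) ->
  exists z, [/\ ~~ odd_perm z, z \in young m & z u = t].
Proof.
move=> um; have [<-|ut] := eqVneq u t.
  by exists 1; rewrite odd_perm1 perm1; split=> //; apply/youngP => i; rewrite perm1.
have [a [b [ab abm [au a_t bu bt]]]] := two_others_side m u t.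
have tm (x y i : 'I_n) : (x < m) = (y < m) -> (tperm x y i < m) = (i < m).
  by move=> xy; case: tpermP => // ->.
exists (tperm u t * tperm a b); rewrite odd_permM !odd_tperm ut ab permM tpermL tpermD //.
by split=> //; apply/youngP => i; rewrite permM !tm.
Qed.

(* The even part of the zero set of a coordinate whose stabilizer contains the
   even permutations fixing t: position t takes one of the values in A. *)
Definition point_set t (A : {set 'I_n}) : {set 'S_n} :=
  [set z : 'S_n | ~~ odd_perm z & z^-1 t \in A].

Definition even_perms : {set 'S_n} := [set z : 'S_n | ~~ odd_perm z].

Lemma mem_even z : (z \in even_perms) = ~~ odd_perm z.
Proof. by rewrite inE. Qed.

Lemma mem_point_set t (A : {set 'I_n}) z :
  (z \in point_set t A) = ~~ odd_perm z && (z^-1 t \in A).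
Proof. by rewrite inE. Qed.

(** If y and z are even with the same preimage of t, then y^-1 z is even and fixes t, hence
    stabilizes Z. *)
Lemma natural_even Z t : natural_at Z t ->
  exists A : {set 'I_n}, forall z, ~~ odd_perm z -> (z \in Z) = (z^-1 t \in A).
Proof.
move/natural_atP => nZ; exists [set z^-1 t | z : 'S_n in [set z in Z | ~~ odd_perm z]] => z ze.
apply/idP/imsetP => [zZ|[y]]; first by exists z; rewrite // inE zZ.
rewrite inE => /andP[yZ ye] ezy.
have [|a [b [ab]]] := @two_others [set t]; first by rewrite cards1.
rewrite !inE => a_t bt.
have hH : y^-1 * z \in stab Z.
  have := @perm_on_class _ (stab Z) [set~ t] a b (y^-1 * z).
  rewrite odd_permM odd_permV (negPf ye) (negPf ze) !inE; apply=> //.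
    by move=> u v; rewrite !inE => ut vt; apply: nZ.
  apply/subsetP => x; rewrite !inE; apply: contraNneq => ->.
  by rewrite permM -ezy permKV.
by rewrite -(mulKVg y z) mem_stab.
Qed.

(** For distinct t and t', even 2-transitivity makes membership of u in A equivalent to membership
    of w in B for all u != w, so the nonempty A is everything. *)
Lemma point_set_inj t t' (A B : {set 'I_n}) :
    A != set0 -> A != setT -> point_set t A = point_set t' B -> t = t' /\ A = B.
Proof.
move=> /set0Pn[v vA] AT eAB.
have mem z u : ~~ odd_perm z -> z u = t -> (z \in point_set t A) = (u \in A).
  by move=> ze zu; rewrite inE ze -zu permK.
have mem' z u : ~~ odd_perm z -> z u = t' -> (z \in point_set t' B) = (u \in B).
  by move=> ze zu; rewrite inE ze -zu permK.
have [ett|tt'] := eqVneq t t'.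
  subst t'; split=> //; apply/setP => u.
  have [|z [ze _ zu]] := @even_young n u t; first by rewrite !ltn_ord.
  by rewrite -(mem z) // -(mem' z) // eAB.
have sep u w : u != w -> (u \in A) = (w \in B).
  move=> uw; have [z [ze zu zw]] := even_two_transitive uw tt'.
  by rewrite -(mem z) // -(mem' z) // eAB.
suff eAT : A = setT by rewrite eAT eqxx in AT.
apply/setP => u; rewrite inE.
have [|w [x [_]]] := @two_others [set u; v]; first by rewrite cards2; case: (_ != _).
rewrite !inE !negb_or => /andP[wu wv] _.
by rewrite (sep u w) 1?eq_sym // -(sep v w) // eq_sym.
Qed.

(** To be instantiated with the zero sets of the coordinates of the section. *)
Variable F : {set {set 'S_n}}.
Hypothesis F_closed : forall Z h, Z \in F -> Z :* h \in F.
Hypothesis F_small : 2 * #|F| < n * n.-1.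
Hypothesis F_sep : forall m z, 0 < m < n -> z \notin young m ->
  exists Z, [/\ Z \in F, young m \subset Z & z \notin Z].

Lemma stab_index Z : #|[set: 'S_n] : stab Z| = #|orbit 'Rs [set: 'S_n] Z|.
Proof. by rewrite card_orbit setTI. Qed.

Lemma orbit_sub Z : Z \in F -> orbit 'Rs [set: 'S_n] Z \subset F.
Proof. by move=> ZF; apply/subsetP => _ /orbitP[h _ <-]; rewrite /= rcosetE F_closed. Qed.

Lemma index_small Z : Z \in F -> 2 * #|[set: 'S_n] : stab Z| < #|'I_n| * #|'I_n|.-1.
Proof.
move=> /orbit_sub/subset_leq_card; rewrite stab_index card_ord.
by move: F_small; move: #|orbit _ _ _| #|F| => a b; lia.
Qed.

Definition separating m Z :=
  [&& Z \in F, young m \subset Z & [exists z : 'S_n, ~~ odd_perm z && (z \notin Z)]].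

(** If h stabilizes Z and z is outside Z, then h cannot send z c to c: z h would fix c and lie in Z.
    So the stabilizer is intransitive and fixes a point. *)
Lemma separating_natural_fix m Z c :
  (forall z, z c = c -> z \in young m) -> separating m Z -> natural Z.
Proof.
move=> cm /and3P[ZF mZ /existsP[z /andP[_ zZ]]].
have [|t fixt] := @fix_of_intransitive _ (stab Z) (z c) c (index_small ZF).
  move=> h hZ; apply: contra zZ => /eqP hzc; rewrite -(mem_stab _ hZ).
  by apply/(subsetP mZ)/cm; rewrite permM.
apply/existsP; exists t; apply/natural_atP.
by apply: (rel3_of_fix (index_small ZF)).
Qed.

Lemma young1_fix (c : 'I_n) : c = 0 :> nat -> forall z, z c = c -> z \in young 1.
Proof.
move=> c0 z zc; apply/youngP => i; rewrite !ltnS !leqn0 -c0 !val_eqE.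
by rewrite -{1}zc (inj_eq perm_inj).
Qed.

Lemma young_last_fix (c : 'I_n) : c = n.-1 :> nat -> forall z, z c = c -> z \in young n.-1.
Proof.
move=> cn z zc; apply/youngP => i.
have lt_ne (j : 'I_n) : (j < n.-1) = (j != c).
  by rewrite -val_eqE /= cn; have := ltn_ord j; lia.
by rewrite !lt_ne -{1}zc (inj_eq perm_inj).
Qed.

Definition traces : {set {set 'I_n}} := [set A |
  [&& A != set0, A != setT &
   [exists Z in F, exists t, natural_at Z t && (Z :&: even_perms == point_set t A)]]].

(** Translating a natural member moves its t to any value and keeps A; [point_set_inj] makes the
    resulting even parts distinct. *)
Lemma traces_card : n * #|traces| <= #|[set Z in F | natural Z]|.
Proof.
rewrite -{1}(card_ord n) -cardsT -cardsX.
rewrite -(card_in_imset (f := fun tA => point_set tA.1 tA.2)); last first.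
  move=> [t A] [t' A']; rewrite !inE /= => /and3P[A0 AT _] _ /(point_set_inj A0 AT).
  by case=> -> ->.
apply: leq_trans (leq_imset_card (fun Z => Z :&: even_perms) _).
apply: subset_leq_card; apply/subsetP => _ /imsetP[[t A] tA ->] /=.
move: tA; rewrite !inE /= => /and3P[_ _ /existsP[Z /andP[ZF /existsP[u]]]].
case/andP => nZ /eqP ZE; have [|z [ze _ zu]] := @even_young n u t; first by rewrite !ltn_ord.
apply/imsetP; exists (Z :* z).
  rewrite !inE F_closed // naturalJ; apply/existsP; by exists u.
apply/setP => y; have /setP/(_ (y * z^-1)) := ZE; rewrite !in_setI !mem_even !mem_point_set mem_rcoset.
rewrite odd_permM odd_permV (negPf ze) addbF invMg invgK permM => ->.
by rewrite zu.
Qed.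

(** Separate the even permutation z = (i j)(a b), with a and b on one side of the cut, from the
    facet. A contains the whole side of t but not z^-1 t, which forces t to be i or j. *)
Lemma separating_trace m (i j : 'I_n) : 0 < m < n -> i < m -> m <= j ->
    (forall Z, separating m Z -> natural Z) ->
  exists2 A, A \in traces &
    ((forall k : 'I_n, k < m -> k \in A) /\ j \notin A) \/
    ((forall k : 'I_n, m <= k -> k \in A) /\ i \notin A).
Proof.
move=> mn im mj nat_sep; have ij : i != j by apply: contraTneq im => ->; rewrite -leqNgt.
have [a [b [ab abm [ai aj bi bj]]]] := two_others_side m i j.
pose z := tperm i j * tperm a b.
have ze : ~~ odd_perm z by rewrite odd_permM !odd_tperm ij ab.
have zi : z i = j by rewrite permM tpermL tpermD.
have zj : z j = i by rewrite permM tpermR tpermD.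
have zm (k : 'I_n) : k != i -> k != j -> (z^-1 k < m) = (k < m).
  move=> ki kj; rewrite invMg !tpermV permM.
  case: (tpermP a b k) => [->|->|_ _]; rewrite tpermD // eq_sym //.
have /(F_sep mn)[Z [ZF mZ zZ]] : z \notin young m.
  by apply/youngP => /(_ i); rewrite zi im ltnNge mj.
have sepZ : separating m Z.
  by apply/and3P; split=> //; apply/existsP; exists z; rewrite ze.
have /existsP[t nZt] := nat_sep Z sepZ; have [A AE] := natural_even nZt.
have tA (k : 'I_n) : (k < m) = (t < m) -> k \in A.
  case/even_young => y [ye ym yk]; rewrite -(permK y k) yk -AE //.
  exact: (subsetP mZ).
have zA : z^-1 t \notin A by rewrite -AE.
exists A.
  rewrite inE; apply/and3P; split.
  - by apply/set0Pn; exists t; apply: tA.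
  - by apply: contraNneq zA => ->; rewrite inE.
  - apply/existsP; exists Z; rewrite ZF; apply/existsP; exists t; rewrite nZt /=.
    apply/eqP/setP => y; rewrite in_setI mem_even mem_point_set andbC.
    by case: (boolP (odd_perm y)) => //= ye; rewrite AE.
have [et|ti] := eqVneq t i.
  left; split=> [k km|]; first by apply: tA; rewrite km et im.
  by rewrite -(permK z j) zj -et.
have [et|tj] := eqVneq t j.
  right; split=> [k km|]; first by apply: tA; rewrite et !ltnNge km mj.
  by rewrite -(permK z i) zi -et.
by case/negP: zA; apply: tA; rewrite zm.
Qed.

(** Cuts 1 and n-1, where naturality is already known, suffice: on the first, second and last points
    a single trace would meet contradictory demands. *)
Lemma two_traces : 1 < #|traces|.
Proof.
have n0 : 0 < n by lia.
have n1 : 1 < n by lia.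
have nl : n.-1 < n by lia.
pose o0 := Ordinal n0; pose o1 := Ordinal n1; pose ol := Ordinal nl.
have nat1 Z : separating 1 Z -> natural Z.
  by apply: (@separating_natural_fix _ _ o0); apply: young1_fix.
have natl Z : separating n.-1 Z -> natural Z.
  by apply: (@separating_natural_fix _ _ ol); apply: young_last_fix.
have [||||A1 A1T A1P] := @separating_trace 1 o0 o1 => //.
have [||||A2 A2T A2P] := @separating_trace 1 o0 ol => //; [by rewrite /=; lia|].
have [||||A3 A3T A3P] := @separating_trace n.-1 o1 ol => //; [by lia|by rewrite /=; lia|].
rewrite ltnNge; apply/negP => /card_le1_eqP T1.
have e2 : A2 = A1 by apply: T1.
have e3 : A3 = A1 by apply: T1.
subst A2 A3; have [oA|oA] := boolP (o0 \in A1); last first.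
  have lA : ol \in A1 by case: A2P => [[/(_ o0 isT)]|[/(_ ol)+ _]]; [rewrite (negPf oA)|apply; rewrite /=; lia].
  have l1 : o1 \in A1 by case: A1P => [[/(_ o0 isT)]|[/(_ o1)+ _]]; [rewrite (negPf oA)|apply].
  by case: A3P => -[_]; rewrite ?lA ?l1.
case: A1P => -[_]; rewrite ?oA // => o1A.
case: A2P => -[_]; rewrite ?oA // => olA.
case: A3P => -[].
  by move=> /(_ o1); rewrite (negPf o1A) /= => H; have : false by apply: H; lia.
by move=> /(_ ol); rewrite (negPf olA) /= => H; have : false by apply: H; lia.
Qed.

(** The orbit of a non-natural Z avoids the at least 2n natural members, so its size is below
    n(n-1)/2 - 2n = n(n-5)/2 and [rel3_of_index] applies. *)
Lemma separating_natural m Z : separating m Z -> natural Z.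
Proof.
move=> /and3P[ZF _ _]; apply: contraT => nnZ.
have disj : orbit 'Rs [set: 'S_n] Z \subset F :\: [set Z in F | natural Z].
  apply/subsetP => W WZ; rewrite !inE (subsetP (orbit_sub ZF)) //= andbT.
  by case/orbitP: WZ => h _ <-; rewrite /= rcosetE naturalJ.
have le1 := subset_leq_card disj; have le2 := traces_card; have le3 := two_traces.
have le4 : #|[set Z in F | natural Z]| + #|F :\: [set Z in F | natural Z]| = #|F|.
  rewrite -(cardsID [set Z in F | natural Z] F); congr (_ + _)%N.
  by apply: eq_card => W; rewrite !inE; case: (W \in F).
have [||t nZ] := @rel3_of_index _ (stab Z); rewrite ?card_ord //.
  have le5 : n * 2 <= n * #|traces| by rewrite leq_mul2l le3 orbT.
  rewrite stab_index; move: F_small le1 le2 le4 le5.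
  have -> : n.-1 = n - 5 + 4 by lia.
  rewrite mulnDr; move: (n * (n - 5))%N (n * #|traces|)%N #|orbit _ _ _| #|F| => a b c d.
  by move: #|F :\: _| => e; move: #|_| => f; lia.
by case/negP: nnZ; apply/existsP; exists t; apply/natural_atP.
Qed.

(* Each cut point m gives a trace whose smallest missing point lies just above the
   cut, or one whose largest missing point lies just below it; hence a trace serves
   at most one m in each of the two ways. *)
Lemma no_small_separating_family : False.
Proof.
(* The index m stands for the cut m + 1, tested on the adjacent points m and m + 1; the boolean
   records which of the two ways occurs. *)
have traceP (m : 'I_n.-1) : exists Ab : {set 'I_n} * bool, (Ab.1 \in traces) &&
    [forall k : 'I_n, if Ab.2 then (k <= m) ==> (k \in Ab.1) else (m < k) ==> (k \in Ab.1)] &&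
    [forall k : 'I_n, if Ab.2 then (k == m.+1 :> nat) ==> (k \notin Ab.1)
                    else (k == m :> nat) ==> (k \notin Ab.1)].
  have mn1 := ltn_ord m; have mn : m < n by lia.
  have m1n : m.+1 < n by lia.
  have [||||A AT] := @separating_trace m.+1 (Ordinal mn) (Ordinal m1n); rewrite /= ?ltnS //.
    exact: separating_natural.
  case=> -[Am oA]; [exists (A, true) | exists (A, false)]; rewrite /= AT /=.
    apply/andP; split; apply/forallP => k; apply/implyP; first exact: Am.
    by move/eqP => km; rewrite (_ : k = Ordinal m1n) //; apply: val_inj.
  apply/andP; split; apply/forallP => k; apply/implyP; first exact: Am.
  by move/eqP => km; rewrite (_ : k = Ordinal mn) //; apply: val_inj.
have [f fP] := fin_all_exists traceP.
have f_inj : injective f.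
  suff lt_ne (m m' : 'I_n.-1) : m < m' -> f m != f m'.
    move=> m m' e; case: (ltngtP m m') => [/lt_ne|/lt_ne|/val_inj //].
      by rewrite e eqxx.
    by rewrite e eqxx.
  move=> mm'; apply/eqP => e; have := fP m'; have := fP m; rewrite -e {e}.
  case: (f m) => A [] /= /andP[/andP[_ /forallP B1] /forallP B2] /andP[/andP[_ /forallP A1] /forallP A2].
    have mn : m.+1 < n by have := ltn_ord m; lia.
    by have := A1 (Ordinal mn); have := B2 (Ordinal mn); rewrite /= eqxx mm' /= => /negPf->.
  have mn : m' < n by have := ltn_ord m'; lia.
  by have := B1 (Ordinal mn); have := A2 (Ordinal mn); rewrite /= eqxx mm' /= => /negPf->.
have : #|'I_n.-1| <= #|setX traces [set: bool]|.
  rewrite -(card_imset _ f_inj); apply: subset_leq_card.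
  apply/subsetP => _ /imsetP[m _ ->].
  by case: (f m) (fP m) => A b /= /andP[/andP[AT _] _]; rewrite in_setX AT in_setT.
rewrite card_ord cardsX cardsT card_bool.
(* Now n - 1 <= 2 #|traces| and n #|traces| <= #|F| contradict [F_small]. *)
have := traces_card; have : #|[set Z in F | natural Z]| <= #|F|.
  by apply: subset_leq_card; apply/subsetP => Z; rewrite inE => /andP[].
move: F_small; move: #|_| #|F| => a b ltb leab leta /(leq_mul (leqnn n)).
by rewrite mulnA; lia.
Qed.

End SeparatingFamilies.

(** * Facets of the permutahedron and zero sets of the section *)

Section Geometry.

Local Open Scope ring_scope.

Variables (R : realType) (n : nat).
Implicit Types (z : 'S_n) (v : 'I_n) (m : nat).

Lemma pact_pvertex (h z : 'S_n) : pact h (pvertex R z) = pvertex R (z * h)%g.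
Proof. by apply/rowP => v; rewrite !mxE invMg permM. Qed.

(** The sum of the first m coordinates of the vertex of z, minimal exactly on the facet. *)
Definition facet_value m z : nat := \sum_(v < n | (v < m)%N) ((z^-1)%g v).+1.

Lemma facet_value_young m z : z \in young n m -> facet_value m z = facet_value m 1%g.
Proof.
move=> /youngP zm; rewrite /facet_value (reindex_inj (@perm_inj _ z)) /= invg1.
by apply: eq_big => [v|v _]; rewrite ?zm // permK perm1.
Qed.

Lemma young_exit m z : z \notin young n m -> exists v, (v < m <= z v)%N.
Proof.
move=> zm; apply/existsP; apply: contraR zm; rewrite negb_exists => /forallP nz.
pose L := [set v : 'I_n | (v < m)%N].
have zL : z @: L = L.
  apply/eqP; rewrite eqEcard card_imset ?leqnn ?andbT; last exact: perm_inj.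
  apply/subsetP => _ /imsetP[v vL ->]; move: (nz v) vL; rewrite !inE.
  by case: ltnP => //= vm; rewrite -ltnNge.
apply/youngP => v; have := mem_imset (mem L) v (@perm_inj _ z).
by rewrite zL !inE.
Qed.

(* Each (i + 1) + (m - i) is at least m + 1, with equality for i < m, and the
   truncated m - i vanishes outside the first m points. *)
Lemma facet_value_gt m z : z \notin young n m -> (facet_value m 1%g < facet_value m z)%N.
Proof.
case/young_exit => u /andP[um uz].
pose D z' := (\sum_(v < n | (v < m)%N) (m - (z'^-1)%g v))%N.
have DE z' : D z' = (\sum_(v < n | (z' v < m)%N) (m - v))%N.
  rewrite /D (reindex_inj (@perm_inj _ z')) /=.
  by apply: eq_bigr => v _; rewrite permK.
have ltD : (D z < D 1%g)%N.
  have -> : D 1%g = (\sum_(v < n) (m - v))%N.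
    rewrite DE [RHS](bigID (fun v : 'I_n => (v < m)%N)) /= [X in (_ + X)%N]big1 ?addn0.
      by apply: eq_bigl => v; rewrite perm1.
    by move=> v; rewrite -leqNgt => mv; apply/eqP; rewrite subn_eq0.
  rewrite DE [ltnRHS](bigID (fun v : 'I_n => (z v < m)%N)) /= -[ltnLHS]addn0 ltn_add2l.
  by rewrite (bigD1 u) /= -?leqNgt // addn_gt0 subn_gt0 um.
have sum1 : (facet_value m 1%g + D 1%g = \sum_(v < n | (v < m)%N) m.+1)%N.
  rewrite -big_split /=; apply: eq_bigr => v vm; rewrite invg1 perm1; lia.
have sumz : (\sum_(v < n | (v < m)%N) m.+1 <= facet_value m z + D z)%N.
  by rewrite -big_split /=; apply: leq_sum => v _; lia.
lia.
Qed.

Lemma facet_value_ge m z : (facet_value m 1%g <= facet_value m z)%N.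
Proof.
have [/facet_value_young -> //|] := boolP (z \in young n m).
by move/facet_value_gt/ltnW.
Qed.

Definition facet_form m (x : 'rV[R]_n) : R := \sum_(v < n | (v < m)%N) x 0 v.

Lemma facet_form_pvertex m z : facet_form m (pvertex R z) = (facet_value m z)%:R.
Proof. by rewrite natr_sum; apply: eq_bigr => v _; rewrite mxE. Qed.

Lemma facet_form_sum m (I : Type) (r : seq I) (P : pred I) (c : I -> R) (x : I -> 'rV[R]_n) :
  facet_form m (\sum_(i <- r | P i) c i *: x i) = \sum_(i <- r | P i) c i * facet_form m (x i).
Proof.
rewrite /facet_form; under eq_bigr do rewrite summxE.
rewrite exchange_big /=; apply: eq_bigr => i _.
by rewrite mulr_sumr; apply: eq_bigr => v _; rewrite mxE.
Qed.

Lemma facet_formB m (x y : 'rV[R]_n) c :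
  facet_form m (x - c *: y) = facet_form m x - c * facet_form m y.
Proof. by rewrite mulr_sumr -sumrB; apply: eq_bigr => v _; rewrite !mxE. Qed.

Lemma facet_form_permutahedron m (x : 'rV[R]_n) :
  permutahedron x -> (facet_value m 1%g)%:R <= facet_form m x.
Proof.
case=> lam [lam0 [lam1 ->]]; rewrite facet_form_sum.
have -> : (facet_value m 1%g)%:R = \sum_z lam z * (facet_value m 1%g)%:R :> R.
  by rewrite -mulr_suml lam1 mul1r.
apply: ler_sum => z _; rewrite facet_form_pvertex; apply: ler_wpM2l => //.
by rewrite ler_nat facet_value_ge.
Qed.

Variables (d : nat) (Q : 'rV[R]_d -> Prop) (p : {linear 'rV[R]_d -> 'rV[R]_n}).
Variable s : 'rV[R]_n -> 'rV[R]_d.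
Hypothesis extQ : subspace_extension Q p.
Hypothesis secs : is_section Q p s.

Definition zero_set (j : 'I_d) : {set 'S_n} := [set z : 'S_n | s (pvertex R z) 0 j == 0].

(* If z lies outside the face, a point slightly beyond the barycentre of the face,
   away from z, still lifts to a nonnegative point of the affine hull of the section,
   unless some coordinate vanishes on the face but not at z. *)
Lemma zero_set_separation m z : z \notin young n m ->
  exists j, (young n m \subset zero_set j) && (z \notin zero_set j).
Proof.
move=> zm; apply/existsP; apply: contraT; rewrite negb_exists => /forallP noj.
have [[L [affL QE]] extP] := extQ.
have inXv z' : inX (pvertex R z') by exists z'.
have sQ z' : Q (s (pvertex R z')) by case: (secs (inXv z')).
have ps z' : p (s (pvertex R z')) = pvertex R z' by case: (secs (inXv z')).
have s0 z' j : 0 <= s (pvertex R z') 0 j by have [_] := (QE _).1 (sQ z'); apply.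
pose a : R := #|young n m|%:R.
have a0 : 0 < a.
  by rewrite ltr0n; apply/card_gt0P; exists 1%g; apply/youngP => v; rewrite perm1.
pose S j := \sum_(y in young n m) s (pvertex R y) 0 j.
have S0 j : 0 <= S j by apply: sumr_ge0.
have Sz j : S j = 0 -> s (pvertex R z) 0 j = 0.
  move=> Sj0; have := noj j; rewrite negb_and negbK => /orP[/negP[]|].
    apply/subsetP => y ym; rewrite inE; apply/eqP.
    by apply: (psumr_eq0P _ Sj0).
  by rewrite inE => /eqP.
(* M bounds every ratio of the coordinate at z to its sum over the face; where S j = 0 the quotient
   is 0 by convention and [Sz] covers the case. *)
pose M := \sum_j s (pvertex R z) 0 j / S j.
have divS0 j : 0 <= s (pvertex R z) 0 j / S j by rewrite divr_ge0.
have M0 : 0 <= M by apply: sumr_ge0.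
have leM j : s (pvertex R z) 0 j <= M * S j.
  have [/Sz ->|Sj] := eqVneq (S j) 0; first by rewrite mulr_ge0.
  rewrite -[leLHS](divfK Sj) ler_wpM2r // /M (bigD1 j) //= lerDl.
  exact: sumr_ge0.
(* This e gives e M <= 1/a <= c, hence nonnegativity; c a - e = 1 makes q an affine combination. *)
pose e := (a * (M + 1))^-1.
have e0 : 0 < e by rewrite invr_gt0 mulr_gt0 // ltr_wpDl.
pose c := (1 + e) / a.
have ca : c * a = 1 + e by rewrite divfK // gt_eqF.
pose q := \sum_(y in young n m) c *: s (pvertex R y) - e *: s (pvertex R z).
have q0 : nonneg q.
  move=> j; rewrite !mxE summxE subr_ge0.
  under eq_bigr do rewrite mxE; rewrite -mulr_sumr.
  apply: (@le_trans _ _ (e * (M * S j))); first by rewrite ler_wpM2l // ltW.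
  rewrite mulrA ler_wpM2r //.
  have -> : e * M = a^-1 - e by rewrite /e; field; rewrite !gt_eqF // ltr_wpDl.
  have -> : c = a^-1 + e / a by rewrite /c mulrDl mul1r.
  by rewrite lerD2l (@le_trans _ _ 0) ?oppr_le0 ?divr_ge0 // ltW.
have Lq : L q.
  case: affL => [noL|[y0 [V LE]]]; first by have [/noL] := (QE _).1 (sQ z).
  apply/LE; have sV z' : s (pvertex R z') - y0 \in V by apply/LE; case: ((QE _).1 (sQ z')).
  have -> : q - y0 = \sum_(y in young n m) c *: (s (pvertex R y) - y0)
                     - e *: (s (pvertex R z) - y0).
    under [in RHS]eq_bigr do rewrite scalerBr.
    rewrite sumrB sumr_const -[_ *+ #|_|]scaler_nat scalerA mulrC ca /q.
    by move: (\sum_(y in _) _) => X; apply/rowP => j; rewrite !mxE; ring.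
  by rewrite rpredB ?rpredZ // rpred_sum // => y _; rewrite rpredZ.
have /facet_form_permutahedron : permutahedron (p q) by apply/extP; exists q; split=> //; apply/QE.
(* At p q the form equals (1 + e) times its minimum minus e times its value at z, which is below the
   minimum. *)
move=> /(_ m); rewrite /q linearB linearZ linear_sum /= ps facet_formB.
under eq_bigr do rewrite linearZ /= ps.
rewrite facet_form_sum facet_form_pvertex.
under eq_bigr => y ym do rewrite facet_form_pvertex facet_value_young //.
rewrite sumr_const -[_ *+ #|_|]mulr_natr -/a (mulrAC c) ca.
have : (facet_value m 1%g)%:R < (facet_value m z)%:R :> R by rewrite ltr_nat facet_value_gt.
by move=> ltz; rewrite mulrDl mul1r -addrA lerDl -mulrBr pmulr_rge0 // subr_ge0 leNgt ltz.
Qed.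

(** The action of h^-1 right-translates vertices by h^-1 and permutes the coordinates of s, so a
    translated zero set is again a zero set. *)
Lemma zero_set_closed (h : 'S_n) j : weakly_symmetric_section s ->
  exists i, (zero_set j :* h)%g = zero_set i.
Proof.
move=> /(_ (h^-1)%g)[k sk]; exists ((k^-1)%g j); apply/setP => y.
rewrite mem_rcoset !inE -pact_pvertex sk ?mxE //; by exists y.
Qed.

End Geometry.

(** * Contradiction from the family of zero sets *)

Local Open Scope ring_scope.

Theorem theorem6 (R : realType) (n d : nat)
  (Q : 'rV[R]_d -> Prop) (p : {linear 'rV[R]_d -> 'rV[R]_n}) (s : 'rV[R]_n -> 'rV[R]_d) :
  (6 <= n)%N ->
  (2 * d < n * (n - 1))%N ->
  subspace_extension Q p ->
  is_section Q p s ->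
  weakly_symmetric_section s ->
  exists (k m : nat) (a : 'I_k -> 'I_n -> 'I_d) (b : 'I_m -> 'I_d),
    bijective (fun u : ('I_k * 'I_n) + 'I_m =>
                 match u with inl it => a it.1 it.2 | inr j => b j end) /\
    (forall pi : 'S_n, pi \in ('Alt_('I_n))%g ->
       forall x, inX x ->
         (forall (i : 'I_k) (t : 'I_n), s (pact pi x) 0 (a i t) = s x 0 (a i ((pi^-1)%g t))) /\
         (forall j : 'I_m, s (pact pi x) 0 (b j) = s x 0 (b j))).
Proof.
move=> n6 small extQ secs symm; exfalso.
apply: (@no_small_separating_family n n6 [set zero_set s j | j : 'I_d]).
- move=> _ h /imsetP[j _ ->]; have [i ->] := zero_set_closed h j symm.
  exact: imset_f.
(* Coordinates may share a zero set, so the family has at most d members. *)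
- apply: leq_ltn_trans (_ : 2 * d < n * n.-1)%N; last by rewrite -subn1.
  by rewrite leq_mul2l /= (leq_trans (leq_imset_card _ _)) // card_ord.
- move=> m z _ /(zero_set_separation extQ secs)[j /andP[mj zj]].
  by exists (zero_set s j); rewrite imset_f.
Qed.
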